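(* Every vertex algebra without vacuum admits a faithful module.
   Context: All vector spaces are over $\mathbb{C}$. $V((x))$ denotes the space of lower truncated formal Laurent series, $\delta(x)=\sum_{n\in\mathbb{Z}}x^n$, and powers $(x\pm y)^n$ are expanded in nonnegative integer powers of the second variable $y$. A vertex algebra without vacuum $(V,Y,D)$ is a vector space $V$ with a linear map $Y(\cdot,x):V\to\mathrm{Hom}(V,V((x)))$, $v\mapsto Y(v,x)=\sum_{n\in\mathbb{Z}}v_nx^{-n-1}$, and a linear operator $D$ on $V$ such that for all $u,v\in V$: the Jacobi identity $$x_0^{-1}\delta\left(\tfrac{x_1-x_2}{x_0}\right)Y(u,x_1)Y(v,x_2)-x_0^{-1}\delta\left(\tfrac{x_2-x_1}{-x_0}\right)Y(v,x_2)Y(u,x_1)=x_2^{-1}\delta\left(\tfrac{x_1-x_0}{x_2}\right)Y(Y(u,x_0)v,x_2),$$ the $D$-derivative property $Y(Dv,x)=\frac{d}{dx}Y(v,x)$, and skew symmetry $Y(u,x)v=e^{xD}Y(v,-x)u$ hold. A (faithful) $V$-module is a vector space $W$ with an (injective) linear map $Y_W(\cdot,x):V\to\mathrm{Hom}(W,W((x)))$ such that for all $u,v\in V$ $$x_0^{-1}\delta\left(\tfrac{x_1-x_2}{x_0}\right)Y_W(u,x_1)Y_W(v,x_2)-x_0^{-1}\delta\left(\tfrac{x_2-x_1}{-x_0}\right)Y_W(v,x_2)Y_W(u,x_1)=x_2^{-1}\delta\left(\tfrac{x_1-x_0}{x_2}\right)Y_W(Y(u,x_0)v,x_2)$$ and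 $Y_W(Dv,x)=\frac{d}{dx}Y_W(v,x)$. *)

(* Defs.v *)
From HB Require Import structures.
From mathcomp Require Import all_boot all_order all_algebra.
From mathcomp Require Import complex.
From mathcomp Require Import all_classical all_reals.

Set Implicit Arguments.
Unset Strict Implicit.
Unset Printing Implicit Defensive.
Import Order.TTheory GRing.Theory Num.Theory.
Local Open Scope classical_set_scope.
Local Open Scope ring_scope.

(* A formal series in x with coefficients in W is the function k |-> (coefficient
   of x^k); a formal series in (x0, x1, x2) is a function of the triple of
   exponents.  The sums \sum_(i \in A) are the finitely supported sums of
   fsbigop: they are 0 on infinitely supported families.  In every use below the
   family is finitely supported, by the lower truncation of vertex operators.
   The complex numbers are R[i], for R a realType. *)

Section FormalSeries.
Variable R : realType.
Implicit Type W : lmodType R[i].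

(* membership in W((x)) *)
Definition laurent W (f : int -> W) : Prop :=
  exists N : int, forall k : int, k < N -> f k = 0.

(* d/dx *)
Definition fderiv W (f : int -> W) : int -> W := fun k => f (k + 1) *~ (k + 1).

(* f(-x) *)
Definition fopp W (f : int -> W) : int -> W := fun k => (-1 : R[i]) ^ k *: f k.

(* e^{xD} f(x) *)
Definition fexp W (D : W -> W) (f : int -> W) : int -> W := fun k =>
  \sum_(i \in [set: nat]) (i`!%:R^-1 : R[i]) *: iter i D (f (k - i%:Z)).

(* n (n - 1) ... (n - i + 1) / i! *)
Definition gbinom (n : int) (i : nat) : R[i] :=
  (\prod_(j < i) (n - j%:Z)%:~R) / i`!%:R.

(* The coefficient of x^a y^b in (x - y)^n, expanded in nonnegative powers
   of y. *)
Definition binexp (n a b : int) : R[i] :=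
  match b with
  | Posz i => if a + i%:Z == n then (-1) ^+ i * gbinom n i else 0
  | Negz _ => 0
  end.

(* The coefficient of z^c x^a y^b in
     z^-1 delta((x - y) / (s z)) = \sum_(n in Z) s^-n z^(-n-1) (x - y)^n,
   where only n = - c - 1 contributes. *)
Definition delta3 (s : R[i]) (c a b : int) : R[i] :=
  s ^ (c + 1) * binexp (- c - 1) a b.

(* Product of a scalar and a W-valued formal series in (x0, x1, x2). *)
Definition fmul3 W (a : int * int * int -> R[i]) (f : int * int * int -> W) :
    int * int * int -> W :=
  fun e => \sum_(d \in [set: int * int * int]) a d *: f (e - d).

End FormalSeries.

Section VertexAlgebra.
Variable R : realType.

(* Y v w k is the coefficient of x^k in Y(v,x)w; in terms of modes,
   v_n w = Y v w (- n - 1).  The linearity is that of Y : V -> (W -> int -> W)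
   and of Y v : W -> (int -> W), for the pointwise lmodType structures. *)
Definition vertex_map (V W : lmodType R[i]) (Y : V -> W -> int -> W) : Prop :=
  [/\ linear Y, forall v, linear (Y v) & forall v w, laurent (Y v w)].

Section Jacobi.
Variables (V W : lmodType R[i]).
Variables (Y : V -> V -> int -> V) (YW : V -> W -> int -> W).

(* Y_W(u,x1) Y_W(v,x2) w *)
Definition prod12 (u v : V) (w : W) : int * int * int -> W :=
  fun '(e0, e1, e2) => if e0 == 0 then YW u (YW v w e2) e1 else 0.

(* Y_W(v,x2) Y_W(u,x1) w *)
Definition prod21 (u v : V) (w : W) : int * int * int -> W :=
  fun '(e0, e1, e2) => if e0 == 0 then YW v (YW u w e1) e2 else 0.

(* Y_W(Y(u,x0)v,x2) w *)
Definition iter02 (u v : V) (w : W) : int * int * int -> W :=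
  fun '(e0, e1, e2) => if e1 == 0 then YW (Y u v e0) w e2 else 0.

Definition jacobi : Prop := forall (u v : V) (w : W) (e : int * int * int),
  fmul3 (fun '(e0, e1, e2) => delta3 1 e0 e1 e2) (prod12 u v w) e
  - fmul3 (fun '(e0, e1, e2) => delta3 (-1) e0 e2 e1) (prod21 u v w) e
  = fmul3 (fun '(e0, e1, e2) => delta3 1 e2 e1 e0) (iter02 u v w) e.

End Jacobi.

Record vertex_algebra_without_vacuum (V : lmodType R[i])
    (Y : V -> V -> int -> V) (D : {linear V -> V}) : Prop := {
  va_vertex_map : vertex_map Y;
  va_jacobi : jacobi Y Y;
  va_deriv : forall v w, Y (D v) w = fderiv (Y v w);
  va_skew : forall u v, Y u v = fexp D (fopp (Y v u)) }.

Record va_module (V : lmodType R[i]) (Y : V -> V -> int -> V)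
    (D : {linear V -> V}) (W : lmodType R[i]) (YW : V -> W -> int -> W) :
    Prop := {
  mod_vertex_map : vertex_map YW;
  mod_jacobi : jacobi Y YW;
  mod_deriv : forall v w, YW (D v) w = fderiv (YW v w) }.

Definition faithful_module (V : lmodType R[i]) (Y : V -> V -> int -> V)
    (D : {linear V -> V}) (W : lmodType R[i]) (YW : V -> W -> int -> W) : Prop :=
  va_module Y D YW /\ injective YW.

End VertexAlgebra.

(* Main.v *)
Require Import Defs.
From HB Require Import structures.
From mathcomp Require Import all_boot all_order all_algebra.
From mathcomp Require Import complex.
From mathcomp Require Import all_classical all_reals.
From mathcomp Require Import ring zify.

Set Implicit Arguments.
Unset Strict Implicit.
Unset Printing Implicit Defensive.
Import Order.TTheory GRing.Theory Num.Theory.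
Local Open Scope classical_set_scope.
Local Open Scope ring_scope.

(* V is embedded in its vacuum extension W = V (+) C.1, on which V acts by
     Y_W(u, x) (w + r 1) = Y(u, x) w + r e^{xD} u;
   faithfulness is clear since the constant term of Y_W(u, x) 1 is u.  The
   Jacobi identity has to be checked on the vector 1 only.  Let J(c, a, b) be the
   coefficient of x_0^c x_1^a x_2^b in the difference of its two sides.  Its delta
   functions are annihilated by x_0 - x_1 + x_2, hence
     J(c, a - 1, b) - J(c, a, b - 1) = J(c - 1, a, b),
   so J vanishes as soon as J(c, -1, b) = 0 for all b and J(c, a, -1) = 0 for
   a >= 0.  The former is e^{yD} Y(u, x) v = Y(u, x + y) e^{yD} v, a consequence
   of D being a derivation; the latter is skew symmetry. *)

(** * Binomial coefficients with an arbitrary integer upper argument *)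

Section BinomialSums.
Variable R : realType.
Local Notation C := R[i].

Lemma signzS (k : int) : (-1 : C) ^ (k + 1) = - (-1) ^ k.
Proof. by rewrite expfzDr ?oppr_eq0 ?oner_eq0// expr1z mulrN1. Qed.

(* binom(k + i, i), which is also the coefficient (-1)^i binom(- k - 1, i) of
   the expansion of (x - y)^(- k - 1). *)
Definition cbinom (k : int) (i : nat) : C := (-1) ^+ i * gbinom R (- k - 1) i.

Lemma cbinom0 k : cbinom k 0 = 1.
Proof. by rewrite /cbinom /gbinom big_ord0 expr0 fact0 divr1 mulr1. Qed.

Lemma cbinomS_mul k i :
  i.+1%:R * cbinom k i.+1 = (k + 1 + i%:Z)%:~R * cbinom k i.
Proof.
rewrite /cbinom /gbinom big_ord_recr/= factS natrM exprS.
have fi0 : (i`!%:R : C) != 0 by rewrite pnatr_eq0 -lt0n fact_gt0.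
have i0 : (i.+1%:R : C) != 0 by rewrite pnatr_eq0.
have -> : (- k - 1 - i%:Z)%:~R = - (k + 1 + i%:Z)%:~R :> C.
  by rewrite -rmorphN/=; congr (_%:~R); ring.
by field; rewrite fi0 addrC -natr1 in i0 *.
Qed.

(** Here the first factor of the product is split off, and in [cbinomS_mul] the last one; both
    express a neighbour of [cbinom k i] as a multiple of it. *)
Lemma cbinom_shift_mul k i :
  i.+1%:R * cbinom (k - 1) i.+1 = k%:~R * cbinom k i.
Proof.
rewrite /cbinom /gbinom big_ord_recl/= factS natrM exprS.
have fi0 : (i`!%:R : C) != 0 by rewrite pnatr_eq0 -lt0n fact_gt0.
have i0 : (i.+1%:R : C) != 0 by rewrite pnatr_eq0.
have -> : (- (k - 1) - 1 - 0%:Z)%:~R = - k%:~R :> C.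
  by rewrite -rmorphN/=; congr (_%:~R); ring.
under eq_bigr => j _.
  have -> : - (k - 1) - 1 - (lift ord0 j)%:Z = - k - 1 - j%:Z.
    by rewrite lift0 -addn1 PoszD; ring.
over.
by field; rewrite fi0 addrC -natr1 in i0 *.
Qed.

(** Pascal's rule, that is, (x - y)^(-k) = (x - y) (x - y)^(-k-1) on coefficients. After
    multiplication by i + 1, both terms in i + 1 become multiples of [cbinom k i]. *)
Lemma cbinom_pascal k i :
  cbinom (k - 1) i.+1 = cbinom k i.+1 - cbinom k i.
Proof.
have i0 : (i.+1%:R : C) != 0 by rewrite pnatr_eq0.
apply: (mulfI i0); rewrite mulrBr cbinom_shift_mul cbinomS_mul -mulrBl.
congr (_ * _); rewrite -[i.+1%:R]/(i.+1%:Z%:~R) -rmorphB/=; congr (_%:~R).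
by rewrite -[i.+1]addn1 PoszD; ring.
Qed.

Lemma cbinomN1 i : cbinom (-1) i = (i == 0)%:R.
Proof.
case: i => [|i]; first exact: cbinom0.
apply: (@mulfI _ i.+1%:R); first by rewrite pnatr_eq0.
by rewrite mulr0 (cbinom_shift_mul 0) mul0r.
Qed.

(** Negation of the upper argument. It serves the iterate term of the Jacobi identity, where the
    power of the binomial grows with [i]. *)
Lemma gbinom_cbinom k i : gbinom R (k + i%:Z) i = cbinom k i.
Proof.
elim: i => [|i IH]; first by rewrite cbinom0 /gbinom big_ord0 fact0 divr1.
apply: (@mulfI _ i.+1%:R); first by rewrite pnatr_eq0.
rewrite cbinomS_mul -IH.
(* At this argument the shift identity is, up to sign, (i + 1) binom(n, i + 1) = n binom(n - 1, i)
   with n = k + i + 1. *)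
have := cbinom_shift_mul (- (k + 1 + i%:Z)) i; rewrite /cbinom.
have -> : - (- (k + 1 + i%:Z) - 1) - 1 = k + i.+1%:Z :> int.
  by rewrite -[i.+1]addn1 PoszD; ring.
have -> : - - (k + 1 + i%:Z) - 1 = k + i%:Z :> int by ring.
rewrite mulrCA [in RHS]mulrCA exprS mulN1r mulNr rmorphN/= mulNr mulrN.
by move/oppr_inj/(mulfI _); apply; rewrite expf_eq0 oppr_eq0 oner_eq0 andbF.
Qed.

Lemma cbinom_fact (m i : nat) :
  cbinom m%:Z i * (m`!%:R * i`!%:R) = (m + i)`!%:R.
Proof.
elim: i => [|i IH]; first by rewrite cbinom0 fact0 addn0 mulr1 mul1r.
rewrite addnS !factS !natrM -IH.
transitivity (i.+1%:R * cbinom m%:Z i.+1 * (m`!%:R * i`!%:R)); first by ring.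
rewrite cbinomS_mul.
have -> : m%:Z + 1 + i%:Z = (m + i).+1%:Z by rewrite -addn1 !PoszD; ring.
by rewrite -mulrA.
Qed.

(** * Finitely supported sums with binomial weights *)

Definition eventually0 (U : lmodType C) (F : nat -> U) :=
  exists M : nat, forall i, (M <= i)%N -> F i = 0.

Definition csum (U : lmodType C) (k : int) (F : nat -> U) : U :=
  \sum_(i \in [set: nat]) cbinom k i *: F i.

Lemma fsbig_nat_trunc (U : lmodType C) (F : nat -> U) (M : nat) :
    (forall i, (M <= i)%N -> F i = 0) ->
  \sum_(i \in [set: nat]) F i = \sum_(i < M) F i.
Proof.
move=> F0; rewrite fsbig_ord; apply/esym/fsbig_widen => // i [_ /= iM].
by apply: F0; rewrite leqNgt; apply/negP.
Qed.

Lemma csum_trunc (U : lmodType C) k (F : nat -> U) (M : nat) :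
    (forall i, (M <= i)%N -> F i = 0) ->
  csum k F = \sum_(i < M) cbinom k i *: F i.
Proof. by move=> F0; apply: fsbig_nat_trunc => i /F0->; rewrite scaler0. Qed.

Lemma eq_csum (U : lmodType C) k (F G : nat -> U) :
  F =1 G -> csum k F = csum k G.
Proof. by move=> FG; apply: eq_fsbigr => i _; rewrite FG. Qed.

Lemma csum0 (U : lmodType C) k (F : nat -> U) :
  (forall i, F i = 0) -> csum k F = 0.
Proof. by move=> F0; apply: fsbig1 => i _; rewrite F0 scaler0. Qed.

(** Lowering [k] by one puts a further factor x - y into the kernel. This is the source of the
    recurrence for the Jacobi coefficients. *)
Lemma csum_pascal (U : lmodType C) k (F : nat -> U) : eventually0 F ->
  csum (k - 1) F = csum k F - csum k (fun i => F i.+1).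
Proof.
case=> M F0.
have F1 i : (M.+1 <= i)%N -> F i = 0 by move/ltnW/F0.
rewrite !(csum_trunc _ F1) (@csum_trunc _ _ _ M); last by move=> i /leqW /F0.
rewrite !big_ord_recl !cbinom0 -addrA -sumrB; congr (_ + _).
by apply: eq_bigr => i _; rewrite lift0/= cbinom_pascal scalerBl.
Qed.

Lemma csumN1 (U : lmodType C) (F : nat -> U) : csum (-1) F = F 0%N.
Proof.
rewrite /csum (@fsbig_nat_trunc _ _ 1%N).
  by rewrite big_ord1 cbinom0 scale1r.
by case=> // i _; rewrite cbinomN1 scale0r.
Qed.

Lemma eventually0_lin (U : lmodType C) r (F G : nat -> U) :
  eventually0 F -> eventually0 G -> eventually0 (fun i => F i + r *: G i).
Proof.
move=> [M F0] [N G0]; exists (maxn M N) => i; rewrite geq_max => /andP[Mi Ni].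
by rewrite F0// G0// scaler0 addr0.
Qed.

Lemma csum_lin (U : lmodType C) k r (F G : nat -> U) :
    eventually0 F -> eventually0 G ->
  csum k (fun i => F i + r *: G i) = csum k F + r *: csum k G.
Proof.
move=> [M F0] [N G0].
have F1 i : (maxn M N <= i)%N -> F i = 0 by rewrite geq_max => /andP[/F0].
have G1 i : (maxn M N <= i)%N -> G i = 0 by rewrite geq_max => /andP[_ /G0].
rewrite (csum_trunc _ F1) (csum_trunc _ G1).
rewrite (@csum_trunc _ _ _ (maxn M N)); last first.
  by move=> i Mi; rewrite F1// G1// scaler0 addr0.
rewrite scaler_sumr -big_split/=; apply: eq_bigr => i _.
by rewrite scalerDr !scalerA [r * _]mulrC.
Qed.

Lemma eventually0Z (U : lmodType C) (r : nat -> C) (F : nat -> U) :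
  eventually0 F -> eventually0 (fun i => r i *: F i).
Proof. by case=> M F0; exists M => i /F0->; rewrite scaler0. Qed.

Lemma csumZ (U : lmodType C) k r (F : nat -> U) : eventually0 F ->
  csum k (fun i => r *: F i) = r *: csum k F.
Proof.
move=> F0; rewrite -[RHS]add0r.
rewrite -[X in X + _](@csum0 _ k (fun=> 0))// -csum_lin//; last by exists 0%N.
by apply: eq_csum => i; rewrite add0r.
Qed.

Lemma csum_pairl (U U' : lmodType C) k (F : nat -> U) : eventually0 F ->
  csum k (fun i => (F i, 0) : U * U') = (csum k F, 0).
Proof.
case=> M F0; rewrite (csum_trunc _ F0) (@csum_trunc _ _ _ M); last first.
  by move=> i /F0->.
rewrite (big_morph (fun x : U => (x, 0 : U')) (id1 := 0) (op1 := +%R))//.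
  by apply: eq_bigr => i _; congr pair; rewrite /= scaler0.
by move=> x y; congr pair; rewrite /= addr0.
Qed.

(** * Coefficients of products with the three delta functions *)

Lemma fsbig_nat_embed (U : lmodType C) (T : choiceType) (h : nat -> T)
    (F : T -> U) :
    injective h -> (forall d, (forall i, d <> h i) -> F d = 0) ->
  \sum_(d \in [set: T]) F d = \sum_(i \in [set: nat]) F (h i).
Proof.
move=> hI F0; rewrite -(@fsbig_image _ _ _ _ _ [set: nat] h); last first.
  by move=> i j _ _ /hI.
apply/esym/fsbig_widen => // d [_ /= dh]; apply: F0 => i dhi.
by apply: dh; exists i.
Qed.

Lemma binexp_neq0 n a b : binexp R n a b != 0 ->
  exists2 i : nat, b = i%:Z & a = n - i%:Z.
Proof.
case: b => i /=; last by rewrite eqxx.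
case: (a + i%:Z =P n) => [<- _|_]; last by rewrite eqxx.
by exists i; rewrite ?addrK.
Qed.

Lemma binexpE n (i : nat) : binexp R n (n - i%:Z) i = (-1) ^+ i * gbinom R n i.
Proof. by rewrite /= subrK eqxx. Qed.

Section FormalProducts.
Variables (U : lmodType C) (f : int * int * int -> U) (c a b : int).

(** The series [f] is free of x_0, so the delta function must supply x_0^c; this fixes the power -c
    - 1 of x_1 - x_2, and only the exponent [i] of x_2 remains to be summed over. *)
Lemma fmul3_delta12 : (forall e, e.1.1 != 0 -> f e = 0) ->
  fmul3 (fun '(e0, e1, e2) => delta3 1 e0 e1 e2) f (c, a, b)
  = csum c (fun i => f (0, a + c + 1 + i%:Z, b - i%:Z)).
Proof.
move=> f0; pose h (i : nat) : int * int * int := (c, - c - 1 - i%:Z, i%:Z).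
rewrite /fmul3 (@fsbig_nat_embed _ _ h); last 2 first.
- by move=> i j [].
- move=> [[d0 d1] d2] dh; have [cd|cd] := eqVneq c d0; last first.
    by rewrite f0 ?scaler0//= subr_eq0.
  have [->|] := eqVneq (delta3 (1 : C) d0 d1 d2) 0; first by rewrite scale0r.
  rewrite /delta3 mulf_eq0 negb_or => /andP[_ /binexp_neq0[i d2i d1i]].
  by case: (dh i); rewrite /h cd d1i d2i.
apply: eq_fsbigr => i _; rewrite /h /delta3 exp1rz mul1r binexpE.
congr (_ *: f _).
by congr (_, _, _) => /=; ring.
Qed.

Lemma fmul3_delta21 : (forall e, e.1.1 != 0 -> f e = 0) ->
  fmul3 (fun '(e0, e1, e2) => delta3 (-1) e0 e2 e1) f (c, a, b)
  = csum c (fun i => (-1) ^ (c + 1) *: f (0, a - i%:Z, b + c + 1 + i%:Z)).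
Proof.
move=> f0; pose h (i : nat) : int * int * int := (c, i%:Z, - c - 1 - i%:Z).
rewrite /fmul3 (@fsbig_nat_embed _ _ h); last 2 first.
- by move=> i j [].
- move=> [[d0 d1] d2] dh; have [cd|cd] := eqVneq c d0; last first.
    by rewrite f0 ?scaler0//= subr_eq0.
  have [->|] := eqVneq (delta3 (-1 : C) d0 d2 d1) 0; first by rewrite scale0r.
  rewrite /delta3 mulf_eq0 negb_or => /andP[_ /binexp_neq0[i d2i d1i]].
  by case: (dh i); rewrite /h cd d1i d2i.
apply: eq_fsbigr => i _; rewrite /h /delta3 binexpE mulrC -scalerA.
congr (_ *: (_ *: f _)); congr (_, _, _) => /=; ring.
Qed.

(** Now x_1^a must come from the delta function. As x_1 occurs inside the binomial, the power of x_1
    - x_0 is not fixed: it is a + i when x_0 has exponent [i]. *)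
Lemma fmul3_delta02 : (forall e, e.1.2 != 0 -> f e = 0) ->
  fmul3 (fun '(e0, e1, e2) => delta3 1 e2 e1 e0) f (c, a, b)
  = csum a (fun i => (-1) ^+ i *: f (c - i%:Z, 0, a + b + 1 + i%:Z)).
Proof.
move=> f0; pose h (i : nat) : int * int * int := (i%:Z, a, - a - 1 - i%:Z).
rewrite /fmul3 (@fsbig_nat_embed _ _ h); last 2 first.
- by move=> i j [].
- move=> [[d0 d1] d2] dh; have [ad|ad] := eqVneq a d1; last first.
    by rewrite f0 ?scaler0//= subr_eq0.
  have [->|] := eqVneq (delta3 (1 : C) d2 d1 d0) 0; first by rewrite scale0r.
  rewrite /delta3 mulf_eq0 negb_or => /andP[_ /binexp_neq0[i d0i d1i]].
  case: (dh i); rewrite /h d0i -ad; congr (_, _, _).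
  by rewrite ad d1i; ring.
apply: eq_fsbigr => i _; rewrite /h /delta3 exp1rz mul1r.
have -> : - (- a - 1 - i%:Z) - 1 = a + i%:Z by ring.
rewrite -{2}[a](addrK i%:Z) binexpE gbinom_cbinom mulrC -scalerA.
by congr (_ *: (_ *: f _)); congr (_, _, _) => /=; ring.
Qed.

End FormalProducts.

(* The three terms of the coefficient of x_0^c x_1^a x_2^b. *)
Lemma jacobiE (V W : lmodType C) (Y : V -> V -> int -> V)
    (YW : V -> W -> int -> W) :
  jacobi Y YW <-> forall u v w c a b,
  csum c (fun i => YW u (YW v w (b - i%:Z)) (a + c + 1 + i%:Z))
  - csum c (fun i => (-1) ^ (c + 1) *:
                     YW v (YW u w (a - i%:Z)) (b + c + 1 + i%:Z))
  = csum a (fun i => (-1) ^+ i *: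
                     YW (Y u v (c - i%:Z)) w (a + b + 1 + i%:Z)).
Proof.
by split=> J u v w => [c a b|[[c a] b]]; have := J u v w;
  [move/(_ (c, a, b))|move/(_ c a b)];
  rewrite fmul3_delta12 1?fmul3_delta21 1?fmul3_delta02//;
  move=> -[[e0 e1] e2] /negPf/= ->.
Qed.

End BinomialSums.

(** * Divided powers of [D] and the series e^{xD} u *)

Section VacuumExtension.
Variables (R : realType) (V : lmodType R[i]) (D : {linear V -> V}).
Local Notation C := R[i].

Definition dpow (i : nat) (x : V) : V := i`!%:R^-1 *: iter i D x.

Lemma dpow_linear i : linear (dpow i).
Proof.
move=> r x y; rewrite /dpow.
have -> : iter i D (r *: x + y) = r *: iter i D x + iter i D y.
  by elim: i => //= i ->; rewrite linearP.
by rewrite scalerDr !scalerA mulrC.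
Qed.

HB.instance Definition _ i :=
  GRing.isLinear.Build C V V *:%R (dpow i) (dpow_linear i).

Lemma dpowZ i r x : dpow i (r *: x) = r *: dpow i x.
Proof. exact: linearZ. Qed.

Lemma dpow0 x : dpow 0 x = x.
Proof. by rewrite /dpow fact0 invr1 scale1r. Qed.

Lemma D_dpow i x : D (dpow i x) = i.+1%:R *: dpow i.+1 x.
Proof.
rewrite /dpow linearZ scalerA factS natrM invfM mulrA divff ?pnatr_eq0//.
by rewrite mul1r.
Qed.

Lemma dpow_D i x : dpow i (D x) = i.+1%:R *: dpow i.+1 x.
Proof. by rewrite -D_dpow /dpow -iterSr/= linearZ. Qed.

Lemma dpow_comp (m i : nat) x :
  dpow m (dpow i x) = cbinom R m i *: dpow (m + i) x.
Proof.
rewrite {2 3}/dpow linearZ/= /dpow -iterD !scalerA; congr (_ *: _).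
have m0 : (m`!%:R : C) != 0 by rewrite pnatr_eq0 -lt0n fact_gt0.
have i0 : (i`!%:R : C) != 0 by rewrite pnatr_eq0 -lt0n fact_gt0.
have b0 : cbinom R m i != 0.
  apply/eqP => b0; have /eqP := cbinom_fact R m i.
  by rewrite b0 mul0r eq_sym pnatr_eq0 gtn_eqF// fact_gt0.
by rewrite -cbinom_fact; field; rewrite m0 i0.
Qed.

(* The coefficient of x^k in e^{xD} u. *)
Definition dexp (u : V) (k : int) : V := if k is Posz i then dpow i u else 0.

Lemma dexp_linear : linear dexp.
Proof.
move=> r u v; apply/funext => -[k|k]; first exact: linearP.
by rewrite /= -[RHS]/(r *: 0 + 0) scaler0 addr0.
Qed.

Lemma dexp0 k : dexp 0 k = 0.
Proof. by case: k => k //=; rewrite linear0. Qed.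

Lemma dexp_lt0 u k : k < 0 -> dexp u k = 0.
Proof. by case: k. Qed.

Lemma dexp_D u k : dexp (D u) k = (k + 1)%:~R *: dexp u (k + 1).
Proof.
case: k => [k|[|k]] /=; first by rewrite dpow_D -PoszD addn1.
  (* At k = -1 the right side meets the constant term [u], which the factor k + 1 = 0 kills. *)
  by rewrite scale0r.
have -> : Negz k.+1 + 1 = Negz k by lia.
by rewrite /= scaler0.
Qed.

Lemma D_dexp u k : D (dexp u k) = (k + 1)%:~R *: dexp u (k + 1).
Proof.
rewrite -dexp_D; case: k => k /=; last by rewrite linear0.
by rewrite D_dpow dpow_D.
Qed.

(** * Consequences of the axioms, and the Jacobi identity on the vector 1 *)

Variable Y : V -> V -> int -> V.
Hypothesis VA : vertex_algebra_without_vacuum Y D.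

Lemma Y_linl r u v w k : Y (r *: u + v) w k = r *: Y u w k + Y v w k.
Proof. by case: (va_vertex_map VA) => -> _ _. Qed.

Lemma Y_linr r u v w k : Y u (r *: v + w) k = r *: Y u v k + Y u w k.
Proof. by case: (va_vertex_map VA) => _ -> _. Qed.

Lemma Y0 u k : Y u 0 k = 0.
Proof. by have := Y_linr (-1) u 0 0 k; rewrite scaler0 addr0 scaleN1r addNr. Qed.

Lemma YZ r u v k : Y u (r *: v) k = r *: Y u v k.
Proof. by rewrite -[_ *: v]addr0 Y_linr Y0 addr0. Qed.

Lemma Y_D u v k : Y (D u) v k = (k + 1)%:~R *: Y u v (k + 1).
Proof. by rewrite (va_deriv VA) /fderiv scaler_int. Qed.

Lemma Y_eventually0 u v k : eventually0 (fun i => Y u v (k - i%:Z)).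
Proof.
have [_ _ /(_ u v)[N YN]] := va_vertex_map VA.
by exists (absz (k - N + 1)) => i Mi; apply: YN; lia.
Qed.

(** The bound [M] is left to the caller, so that expansions of different series can be summed over
    matching ranges. *)
Lemma Y_skew u v k M : (forall i, (M <= i)%N -> Y v u (k - i%:Z) = 0) ->
  Y u v k = \sum_(i < M) (-1) ^ (k - i%:Z) *: dpow i (Y v u (k - i%:Z)).
Proof.
move=> YM; rewrite (va_skew VA) /fexp (@fsbig_nat_trunc _ _ _ M).
  by apply: eq_bigr => i _; rewrite -/(dpow i _) /fopp linearZ.
by move=> i Mi; rewrite -/(dpow i _) /fopp YM// scaler0 linear0.
Qed.

(** Skew symmetry turns all three terms into sums of divided powers applied to coefficients of
    Y(v,x)u. The summands of index 0 on the right cancel; the others match because (k + 1) - (k - i)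
    = i + 1. *)
Lemma D_derivation u v k : D (Y u v k) = Y (D u) v k + Y u (D v) k.
Proof.
have [M YM] := Y_eventually0 v u (k + 1).
have YM1 i : (M.+1 <= i)%N -> Y v u (k + 1 - i%:Z) = 0 by move/ltnW/YM.
have YM0 i : (M <= i)%N -> Y v u (k - i%:Z) = 0.
  by move/leqW/YM; rewrite -addn1 PoszD opprD addrACA subrr addr0.
have YMD i : (M.+1 <= i)%N -> Y (D v) u (k - i%:Z) = 0.
  by move=> /YM1 Yi; rewrite Y_D addrAC Yi scaler0.
rewrite (Y_skew YM0) Y_D (Y_skew YM1) (Y_skew YMD).
rewrite scaler_sumr -big_split/= big_ord_recl/= linear_sum/=.
rewrite Y_D !dpow0 !subr0 signzS scaleNr scalerN !scalerA.
rewrite [(k + 1)%:~R * _]mulrC addNr add0r.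
apply: eq_bigr => i _; rewrite /bump/= add1n Y_D.
have -> : k + 1 - i.+1%:Z = k - i%:Z by rewrite -addn1 PoszD; ring.
have -> : k - i.+1%:Z + 1 = k - i%:Z by rewrite -addn1 PoszD; ring.
have -> : (-1) ^ (k - i%:Z) = - (-1) ^ (k - i.+1%:Z) :> C.
  by rewrite -signzS; congr (_ ^ _); rewrite -addn1 PoszD; ring.
rewrite linearZ/= D_dpow dpowZ !scalerA -scalerDl; congr (_ *: _).
rewrite -[i.+1%:R]/(i.+1%:Z%:~R) -addn1 PoszD !rmorphB/= !rmorphD/=; ring.
Qed.

(* The coefficient of x^c y^b in [e^{yD} Y(u,x) v = Y(u,x+y) e^{yD} v]. *)
Lemma dexp_Y u v c b :
  csum c (fun i => Y u (dexp v (b - i%:Z)) (c + i%:Z)) = dexp (Y u v c) b.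
Proof.
case: b => b; last first.
  by rewrite csum0// => i; rewrite dexp_lt0 ?Y0//; lia.
elim: b c => [|b IH] c.
  rewrite (@csum_trunc _ _ _ _ 1%N).
    by rewrite big_ord1 cbinom0 scale1r addr0 subr0 /= !dpow0.
  by case=> // i _; rewrite dexp_lt0 ?Y0//; lia.
have b0 : (b.+1%:R : C) != 0 by rewrite pnatr_eq0.
(* Up to the factor b + 1, degree b + 1 is obtained by applying [D] to the identity in degree
   [b]. *)
apply: (scalerI b0); rewrite /= -D_dpow -[dpow b _]/(dexp _ b%:Z) -IH.
rewrite (@csum_trunc _ _ _ _ b.+2); last first.
  by move=> i ib; rewrite dexp_lt0 ?Y0//; lia.
rewrite (@csum_trunc _ _ _ _ b.+1); last first.
  by move=> i ib; rewrite dexp_lt0 ?Y0//; lia.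
pose t j := cbinom R c j *: Y u (dexp v (b.+1%:Z - j%:Z)) (c + j%:Z).
(* The factor b + 1 is split as j + (b + 1 - j): the first part, reindexed, comes from [D] acting on
   [u], the second from [D] acting on e^{yD} v. *)
transitivity (\sum_(j < b.+2) j%:R *: t j
              + \sum_(j < b.+2) (b.+1%:Z - j%:Z)%:~R *: t j).
  rewrite scaler_sumr -big_split; apply: eq_bigr => j _ /=.
  rewrite -scalerDl; congr (_ *: _); rewrite rmorphB [RHS]addrC.
  exact: (esym (subrK _ _)).
rewrite big_ord_recl scale0r add0r [X in _ + X]big_ord_recr/= subrr scale0r addr0.
rewrite linear_sum -big_split; apply: eq_bigr => j _ /=.
rewrite [RHS]linearZ/= D_derivation Y_D D_dexp YZ scalerDr !scalerA.
rewrite /bump add1n cbinomS_mul.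
have -> : b%:Z - j%:Z + 1 = b.+1%:Z - j%:Z by lia.
have -> : b.+1%:Z - j.+1%:Z = b%:Z - j%:Z.
  by lia.
have -> : c + j.+1%:Z = c + j%:Z + 1 by lia.
by congr (_ *: _ + _ *: _); rewrite mulrC // addrAC.
Qed.

(* The Jacobi identity of V (+) C.1 applied to the vector 1. *)
Definition vac_jacobi u v c a b :=
  csum c (fun i => Y u (dexp v (b - i%:Z)) (a + c + 1 + i%:Z))
  - csum c (fun i => (-1) ^ (c + 1) *:
                     Y v (dexp u (a - i%:Z)) (b + c + 1 + i%:Z))
  - csum a (fun i => (-1) ^+ i *:
                     dexp (Y u v (c - i%:Z)) (a + b + 1 + i%:Z)).

Lemma dexp_eventually0 u v b (h : int -> int) :
  eventually0 (fun i => Y u (dexp v (b - i%:Z)) (h i)).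
Proof. by exists (absz b).+1 => i bi; rewrite dexp_lt0 ?Y0//; lia. Qed.

Lemma iterate_eventually0 u v c (h : int -> int) :
  eventually0 (fun i => dexp (Y u v (c - i%:Z)) (h i)).
Proof.
by have [M YM] := Y_eventually0 u v c; exists M => i /YM->; rewrite dexp0.
Qed.

(* Each of the three delta functions of the Jacobi identity is annihilated by
   x_0 - x_1 + x_2. *)
Lemma vac_jacobi_rec u v c a b :
  vac_jacobi u v c (a - 1) b - vac_jacobi u v c a (b - 1)
  = vac_jacobi u v (c - 1) a b.
Proof.
have comm u' v' a' b' :
    csum c (fun i => Y u' (dexp v' (b' - i%:Z)) (a' - 1 + c + 1 + i%:Z))
    - csum c (fun i => Y u' (dexp v' (b' - 1 - i%:Z)) (a' + c + 1 + i%:Z))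
    = csum (c - 1)
        (fun i => Y u' (dexp v' (b' - i%:Z)) (a' + (c - 1) + 1 + i%:Z)).
  rewrite csum_pascal; last exact: dexp_eventually0.
  congr (_ - _); apply: eq_csum => i; first by congr (Y _ _ _); lia.
  by congr (Y _ (dexp _ _) _); lia.
(* Here Pascal's rule applies in [a]: its unshifted sum cancels against the term with b - 1, and the
   shifted one lowers [c], its minus sign being absorbed by (-1)^(i+1). *)
have assoc :
    csum (a - 1) (fun i => (-1) ^+ i *:
                     dexp (Y u v (c - i%:Z)) (a - 1 + b + 1 + i%:Z))
    - csum a (fun i => (-1) ^+ i *:
                     dexp (Y u v (c - i%:Z)) (a + (b - 1) + 1 + i%:Z))
    = csum a (fun i => (-1) ^+ i *:
                     dexp (Y u v (c - 1 - i%:Z)) (a + b + 1 + i%:Z)).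
  rewrite csum_pascal; last exact/eventually0Z/iterate_eventually0.
  have -> : csum a (fun i => (-1) ^+ i *:
                     dexp (Y u v (c - i%:Z)) (a - 1 + b + 1 + i%:Z))
          = csum a (fun i => (-1) ^+ i *:
                     dexp (Y u v (c - i%:Z)) (a + (b - 1) + 1 + i%:Z)).
    by apply: eq_csum => i; congr (_ *: dexp _ _); lia.
  rewrite addrAC subrr sub0r -scaleN1r -csumZ; last first.
    case: (iterate_eventually0 u v c (fun i => a - 1 + b + 1 + i)) => M YM.
    by exists M => i Mi; rewrite YM ?scaler0//; lia.
  apply: eq_csum => i; rewrite scalerA exprS !mulN1r opprK.
  by congr (_ *: dexp (Y _ _ _) _); lia.
rewrite /vac_jacobi -comm -assoc.
rewrite !csumZ; try exact: dexp_eventually0.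
(* For the opposite order x_1 and x_2 are exchanged, which reverses the difference; the sign
   (-1)^(c+1) = - (-1)^c compensates. *)
rewrite -(comm v u b a) subrK signzS.
rewrite scalerBr !scaleNr !opprK.
have regroup (x1 x2 y1 y2 z1 z2 : V) :
    x1 + y1 - z1 - (x2 + y2 - z2) = x1 - x2 - (y2 - y1) - (z1 - z2).
  by rewrite (opprB y2) (opprD z1) opprD (opprD x2) addrACA
    [in LHS](addrACA x1).
exact: regroup.
Qed.

(** The second product vanishes since e^{xD} u has no negative powers, and the iterate sum keeps
    only i = 0; what remains is [dexp_Y]. *)
Lemma vac_jacobi_iterate u v c b : vac_jacobi u v c (-1) b = 0.
Proof.
rewrite /vac_jacobi [X in _ - X - _]csum0; last first.
  by move=> i; rewrite dexp_lt0 ?Y0 ?scaler0//; lia.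
rewrite csumN1 expr0 scale1r !subr0 (_ : -1 + b + 1 = b) -?dexp_Y; last lia.
apply/eqP; rewrite subr_eq0; apply/eqP/eq_csum => i.
by congr (Y _ _ _); lia.
Qed.

(** The first product vanishes and [dexp_Y] sums the second. Since a >= 0, the iterate term is a sum
    of composites of divided powers, so the claim is skew symmetry under [dpow a]. *)
Lemma vac_jacobi_skew u v c (a : nat) : vac_jacobi u v c a (-1) = 0.
Proof.
have [M YM] := Y_eventually0 u v c.
rewrite /vac_jacobi csum0; last by move=> i; rewrite dexp_lt0 ?Y0//; lia.
rewrite csumZ; last exact: dexp_eventually0.
have -> : csum c (fun i => Y v (dexp u (a%:Z - i%:Z)) (-1 + c + 1 + i%:Z))
        = dexp (Y v u c) a.
  by rewrite -dexp_Y; apply: eq_csum => i; congr (Y _ _ _); lia.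
rewrite (@csum_trunc _ _ _ _ M); last by move=> i /YM->; rewrite dexp0 scaler0.
rewrite (Y_skew YM) sub0r signzS scaleNr opprK /= linear_sum scaler_sumr.
apply/eqP; rewrite subr_eq0; apply/eqP/eq_bigr => i _ /=.
rewrite dpowZ dpow_comp 2!scalerA [RHS]scalerA addrNK -PoszD /= mulrC.
congr (_ * _ *: _).
have M1 : (-1 : C) != 0 by rewrite oppr_eq0 oner_eq0.
rewrite -{1}[c](subrK i%:Z) expfzDr// mulrAC -expfzMl mulrNN mulr1 exp1rz.
by rewrite mul1r.
Qed.

Lemma vac_jacobi0 u v c a b : vac_jacobi u v c a b = 0.
Proof.
(* For a, b >= -1 the recurrence at c + 1 expresses J(c, a, b) by values with smaller [a] or [b],
   down to the two boundary lemmas. *)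
have pos m n c' : vac_jacobi u v c' (m%:Z - 1) (n%:Z - 1) = 0.
  elim: m n c' => [|m IHm] n c'; first by rewrite sub0r vac_jacobi_iterate.
  have em : m.+1%:Z - 1 = m by lia.
  elim: n c' => [|n IHn] c'; first by rewrite em sub0r vac_jacobi_skew.
  have en : n.+1%:Z - 1 = n by lia.
  have := vac_jacobi_rec u v (c' + 1) m n.
  by rewrite addrK em en => <-; rewrite -en IHm en -em IHn subr0.
have ge_N1 k : -1 <= k -> k = (absz (k + 1)%R)%:Z - 1 by lia.
have le_N1 k : k <= -1 -> k = -1 - (absz (-1 - k)%R)%:Z by lia.
(* Below a = -1 the recurrence is solved for J(c, a - 1, b), with [b] arbitrary. *)
have neg m b' c' : vac_jacobi u v c' (-1 - m%:Z) b' = 0.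
  elim: m b' c' => [|m IH] b' c'; first by rewrite subr0 vac_jacobi_iterate.
  have := vac_jacobi_rec u v c' (-1 - m%:Z) b'; rewrite !IH subr0.
  by have -> : -1 - m%:Z - 1 = -1 - m.+1%:Z by lia.
(* Below b = -1 it is solved for J(c, a, b - 1); the row b = -1 is covered by [pos] and [neg]. *)
have negb n a' c' : vac_jacobi u v c' a' (-1 - n%:Z) = 0.
  elim: n a' c' => [|n IH] a' c'.
    have [a0|/ltW a0] := leP (-1) a'.
      by rewrite (ge_N1 a' a0) subr0 -(sub0r 1) pos.
    by rewrite (le_N1 a' a0) neg.
  have := vac_jacobi_rec u v c' a' (-1 - n%:Z); rewrite !IH sub0r => /eqP.
  rewrite oppr_eq0 => /eqP.
  by have -> : -1 - n%:Z - 1 = -1 - n.+1%:Z by lia.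
have [a0|/ltW a0] := leP (-1) a; last by rewrite (le_N1 a a0) neg.
have [b0|/ltW b0] := leP (-1) b; last by rewrite (le_N1 b b0) negb.
by rewrite (ge_N1 a a0) (ge_N1 b b0) pos.
Qed.

(** * The faithful module structure on the vacuum extension *)

Local Notation W := (V * C^o)%type.

(** Every operator maps into V, so in a composite only the innermost one meets the vector 1. *)
Definition vac_ext (u : V) (x : W) (k : int) : W :=
  (Y u x.1 k + x.2 *: dexp u k, 0).

Lemma vac_ext_vertex_map : vertex_map vac_ext.
Proof.
split.
- move=> r u v; apply/funext => x; apply/funext => k.
  rewrite -[RHS]/(r *: vac_ext u x k + vac_ext v x k) /vac_ext Y_linl.
  rewrite dexp_linear -[(_ + _ : int -> V) k]/(r *: dexp u k + dexp v k).
  congr pair; last by rewrite /= scaler0 addr0.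
  by rewrite /= !scalerDr addrACA !scalerA mulrC.
- move=> u r x y; apply/funext => k.
  rewrite -[RHS]/(r *: vac_ext u x k + vac_ext u y k).
  congr pair; last by rewrite /= scaler0 addr0.
  by rewrite /= Y_linr scalerDl -[r *: x.2]/(r * x.2) -scalerA addrACA scalerDr.
- move=> u x; have [_ _ /(_ u x.1)[N YN]] := va_vertex_map VA.
  exists (Num.min N 0) => k; rewrite lt_min => /andP[/YN Yk k0].
  by rewrite /vac_ext Yk dexp_lt0// scaler0 addr0.
Qed.

Lemma vac_ext_comp u v w r k l :
  vac_ext u (vac_ext v (w, r) k) l
  = (Y u (Y v w k) l + r *: Y u (dexp v k) l, 0).
Proof. by rewrite /vac_ext /= scale0r addr0 addrC Y_linr addrC. Qed.

Lemma Y_jacobi u v w c a b :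
  csum c (fun i => Y u (Y v w (b - i%:Z)) (a + c + 1 + i%:Z))
  - csum c (fun i => (-1) ^ (c + 1) *:
                     Y v (Y u w (a - i%:Z)) (b + c + 1 + i%:Z))
  - csum a (fun i => (-1) ^+ i *:
                     Y (Y u v (c - i%:Z)) w (a + b + 1 + i%:Z)) = 0.
Proof.
by have /jacobiE J := va_jacobi VA; apply/eqP; rewrite subr_eq0; apply/eqP/J.
Qed.

Lemma Y0l w k : Y 0 w k = 0.
Proof. by have := Y_linl (-1) 0 0 w k; rewrite scaler0 addr0 scaleN1r addNr. Qed.

Lemma YY_eventually0 u v w b (h : int -> int) :
  eventually0 (fun i => Y u (Y v w (b - i%:Z)) (h i)).
Proof.
by have [M YM] := Y_eventually0 v w b; exists M => i /YM->; rewrite Y0.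
Qed.

Lemma Y_iterate_eventually0 u v w c (h : int -> int) :
  eventually0 (fun i => Y (Y u v (c - i%:Z)) w (h i)).
Proof.
by have [M YM] := Y_eventually0 u v c; exists M => i /YM->; rewrite Y0l.
Qed.

Lemma vac_ext_jacobi : jacobi Y vac_ext.
Proof.
apply/jacobiE => u v [w r] c a b.
pose pairl (x : V) : W := (x, 0).
(* Each of the three sums splits into its value on [w] and [r] times its value on 1, so that
   [Y_jacobi] and [vac_jacobi0] apply separately. *)
have lin k (s : nat -> C) (F G : nat -> V) (H : nat -> W) :
    eventually0 F -> eventually0 G ->
    (forall i, H i = s i *: pairl (F i + r *: G i)) ->
    csum k H = pairl (csum k (fun i => s i *: F i)
                      + r *: csum k (fun i => s i *: G i)).
  move=> F0 G0 HE; rewrite -csum_lin; try exact: eventually0Z.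
  rewrite /pairl -csum_pairl; last by apply: eventually0_lin; exact: eventually0Z.
  apply: eq_csum => i; rewrite HE; congr pair; last exact: scaler0.
  by rewrite /= scalerDr !scalerA mulrC.
rewrite (lin c (fun=> 1) (fun i => Y u (Y v w (b - i%:Z)) (a + c + 1 + i%:Z))
  (fun i => Y u (dexp v (b - i%:Z)) (a + c + 1 + i%:Z))); first last.
- by move=> i; rewrite scale1r vac_ext_comp.
- exact: dexp_eventually0.
- exact: YY_eventually0.
rewrite (lin c (fun=> (-1) ^ (c + 1))
  (fun i => Y v (Y u w (a - i%:Z)) (b + c + 1 + i%:Z))
  (fun i => Y v (dexp u (a - i%:Z)) (b + c + 1 + i%:Z))); first last.
- by move=> i; rewrite vac_ext_comp.
- exact: dexp_eventually0.
- exact: YY_eventually0.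
rewrite (lin a (fun i => (-1) ^+ i)
  (fun i => Y (Y u v (c - i%:Z)) w (a + b + 1 + i%:Z))
  (fun i => dexp (Y u v (c - i%:Z)) (a + b + 1 + i%:Z))); first last.
- by [].
- exact: iterate_eventually0.
- exact: Y_iterate_eventually0.
apply/eqP; rewrite -subr_eq0; apply/eqP; congr pair; last by rewrite /= !subr0.
have := vac_jacobi0 u v c a b; rewrite /vac_jacobi => J1.
have J2 := Y_jacobi u v w c a b.
rewrite /= !(@eq_csum _ _ c (fun i => 1 *: _) _ (fun i => scale1r _)).
have regroup (x1 x2 x3 y1 y2 y3 : V) :
    x1 + r *: y1 - (x2 + r *: y2) - (x3 + r *: y3)
    = (x1 - x2 - x3) + r *: (y1 - y2 - y3).
  by rewrite !scalerBr !opprD (addrACA x1) (addrACA (x1 - x2)).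
by rewrite regroup J1 J2 scaler0 addr0.
Qed.

Lemma vac_ext_faithful : faithful_module Y D vac_ext.
Proof.
split; first split.
- exact: vac_ext_vertex_map.
- exact: vac_ext_jacobi.
- move=> v x; apply/funext => k; rewrite /vac_ext /fderiv Y_D dexp_D.
  rewrite -scaler_int; congr pair; last by rewrite /= scaler0.
  by rewrite /= scalerDr !scalerA mulrC.
- move=> u v /(congr1 (fun f => (f (0, 1) 0).1)).
  by rewrite /vac_ext /= !Y0 !add0r !scale1r !dpow0.
Qed.

End VacuumExtension.

Theorem corollary2p10 (R : realType) (V : lmodType R[i])
    (Y : V -> V -> int -> V) (D : {linear V -> V}) :
  vertex_algebra_without_vacuum Y D ->
  exists (W : lmodType R[i]) (YW : V -> W -> int -> W),
    faithful_module Y D YW.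
Proof.
by move=> VA; exists (V * R[i]^o)%type, (vac_ext D Y); exact: vac_ext_faithful.
Qed.
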